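(* Let $n, k, t$ be positive integers with $t < \frac{n}{3k^2}$. Let $\mathcal{F}_1, \ldots, \mathcal{F}_t$ be families of $k$-element subsets of $[n]$ such that $|\mathcal{F}_i| > \binom{n}{k} - \binom{n-t+1}{k}$ for every $1 \leq i \leq t$. Then there exist pairwise disjoint sets $F_1 \in \mathcal{F}_1, \ldots, F_t \in \mathcal{F}_t$.
   Context: $[n] = \{1, \ldots, n\}$. The families $\mathcal{F}_1,\ldots,\mathcal{F}_t$ are sets of subsets (no repeated members within a family), but they need not be distinct or disjoint from one another. *)

(* Defs.v *)
From mathcomp Require Export all_boot all_order all_algebra.

Set Implicit Arguments.
Unset Strict Implicit.
Unset Printing Implicit Defensive.

(* Main.v *)
Require Import Defs.
From mathcomp Require Import all_boot all_order all_algebra.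
From mathcomp Require Import zify ring.

Set Implicit Arguments.
Unset Strict Implicit.
Unset Printing Implicit Defensive.

Import GRing.Theory Num.Theory.

(** The argument is that of Huang, Loh and Sudakov, run as a double induction:
    on the uniformity k and, for fixed k, on the number t = s + 1 of families,
    over an arbitrary finite ground set of n points.  Put D = 'C(n - 2, k - 2),
    the number of k-sets through two given points.

    For k = 1 it suffices to pick distinct points greedily, and for t = 1 the
    size hypothesis says that F_1 is nonempty.

    If some family F_i has a vertex v of degree more than k s D, delete v from
    all the other families.  Since 'C(n, k) - 'C(n - 1, k) = 'C(n - 1, k - 1)
    bounds the degree of v, the other s families stay large enough for the
    induction on s ([large_delete]).  The disjoint sets this gives cover at most
    k s points other than v, which meet at most k s D members of F_i through v;
    so one such member is disjoint from all of them.

    Otherwise all degrees are at most k s D.  Call v heavy for F_i when its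
    degree there exceeds 2 s D.

    If every F_i has at least t heavy vertices, choose distinct heavy vertices
    v_i greedily.  Discarding from the link of v_i the sets that contain some
    other v_j costs at most s D, so more than s D sets of size k - 1 remain.
    Since 'C(m, k - 1) - 'C(m - s, k - 1) <= s 'C(m - 1, k - 2), with
    m = n - t, that is enough for the induction on k ([card_link_ge],
    [bin_sub_upper], [rainbow_links]).

    If some F_i has at most s heavy vertices, apply the induction on s to the
    other families.  Their disjoint representatives cover at most k s points, of
    which at most s are heavy for F_i, and so they meet at most
    s (k s D) + (k s - s) (2 s D) = s^2 (3k - 2) D members of F_i.  The
    hypothesis 3 k^2 t < n makes this smaller than |F_i| ([bin_gap]). *)

(** * Binomial estimates *)

(** By Pascal's rule the difference 'C(m, k + 1) - 'C(m - s, k + 1) is the sum of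
    'C(m - j, k) for 1 <= j <= s; this lemma keeps the smallest summand and
    [bin_sub_upper] the largest. *)
Lemma bin_sub_lower m s k : s <= m ->
  'C(m - s, k.+1) + s * 'C(m - s, k) <= 'C(m, k.+1).
Proof.
elim: s => [|s IHs] le_sm; first by rewrite subn0 mul0n addn0.
apply: leq_trans _ (IHs (ltnW le_sm)).
have -> : m - s = (m - s.+1).+1 by lia.
have : 'C(m - s.+1, k) <= 'C((m - s.+1).+1, k) by apply: leq_bin2l.
rewrite binS; nia.
Qed.

Lemma bin_sub_upper m s k : s <= m ->
  'C(m, k.+1) <= 'C(m - s, k.+1) + s * 'C(m.-1, k).
Proof.
elim: s => [|s IHs] le_sm; first by rewrite subn0 mul0n addn0.
apply: leq_trans (IHs (ltnW le_sm)) _.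
have -> : m - s = (m - s.+1).+1 by lia.
have : 'C(m - s.+1, k) <= 'C(m.-1, k) by apply: leq_bin2l; lia.
rewrite binS; nia.
Qed.

(** With k.+2 as the uniformity, 3 * k + 4 is 3 k.+2 - 2.  This is where the
    assumption on n is used: 'C(n - 1, k + 1) is (n - 1) / (k + 1) times
    'C(n - 2, k), and replacing n - 1 by n - s in the former loses at most s - 1
    copies of the latter. *)
Lemma bin_gap n s k : 0 < s -> 3 * k.+2 ^ 2 * s.+1 < n ->
  s ^ 2 * (3 * k + 4) * 'C(n - 2, k) + 'C(n - s, k.+2) <= 'C(n, k.+2).
Proof.
move=> s_gt0 lt_n.
have le_sn : s <= n by nia.
apply: leq_trans _ (bin_sub_lower _ le_sn).
rewrite addnC leq_add2l -mulnn -!mulnA leq_pmul2l //.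
have up : 'C(n.-1, k.+1) <= 'C(n - s, k.+1) + s.-1 * 'C(n - 2, k).
  have := @bin_sub_upper n.-1 s.-1 k.
  have -> : n.-1 - s.-1 = n - s by lia.
  have -> : n.-2 = n - 2 by lia.
  by apply; lia.
have diag : n.-1 * 'C(n - 2, k) = k.+1 * 'C(n.-1, k.+1).
  have -> : n - 2 = n.-2 by lia.
  by rewrite mul_bin_diag.
(* Multiplying by k + 1 turns 'C(n - 1, k + 1) into a multiple of 'C(n - 2, k). *)
rewrite -(leq_pmul2l (ltn0Sn k)).
have : k.+1 * 'C(n.-1, k.+1) <= k.+1 * ('C(n - s, k.+1) + s.-1 * 'C(n - 2, k)).
  by rewrite leq_pmul2l.
rewrite -diag.
suff : (k.+1 * (s * (3 * k + 4)) + k.+1 * s.-1) * 'C(n - 2, k)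
  <= n.-1 * 'C(n - 2, k) by nia.
by apply: leq_mul => //; nia.
Qed.

(** * Degrees in uniform families *)

Section Families.
Variables T I : finType.
Implicit Types (S U V X A B : {set T}) (G : {set {set T}}) (P : {set I}).
Implicit Type F : I -> {set {set T}}.

Definition ksubsets S k := [set A : {set T} | A \subset S & #|A| == k].
Definition star G v := [set A in G | v \in A].
Definition meeting G U := [set A in G | ~~ [disjoint A & U]].

(** Removing X from the members of G is injective and lands in the k-subsets of
    S :\: X. *)
Lemma card_superset_family G S X k :
  X \subset S -> {in G, forall A, [/\ X \subset A, A \subset S & #|A| = #|X| + k]} ->
  #|G| <= 'C(#|S| - #|X|, k).
Proof.
move=> sXS hG.
have <- : #|S :\: X| = #|S| - #|X| by rewrite cardsD (setIidPr sXS).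
rewrite -cards_draws.
have inj : {in G &, injective (fun A => A :\: X)}.
  move=> A B /hG[sXA _ _] /hG[sXB _ _] eqAB.
  by rewrite -(setID A X) -(setID B X) eqAB (setIidPr sXA) (setIidPr sXB).
rewrite -(card_in_imset inj); apply/subset_leq_card/subsetP=> _ /imsetP[A AG ->].
have [sXA sAS cA] := hG A AG.
by rewrite inE setSD //= cardsD (setIidPr sXA) cA addKn.
Qed.

Lemma card_star_le G S v k : G \subset ksubsets S k.+1 -> v \in S ->
  #|star G v| <= 'C(#|S|.-1, k).
Proof.
move=> /subsetP sG vS; rewrite -subn1 -(cards1 v).
apply: card_superset_family => [|A]; first by rewrite sub1set.
rewrite inE => /andP[/sG]; rewrite inE => /andP[sAS /eqP cA] vA.
by rewrite sub1set cards1.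
Qed.

Lemma card_star2_le G S u v k : G \subset ksubsets S k.+2 ->
  u \in S -> v \in S -> u != v -> #|star (star G v) u| <= 'C(#|S| - 2, k).
Proof.
move=> /subsetP sG uS vS neq.
have c2 : #|[set u; v]| = 2 by rewrite cards2 neq.
rewrite -c2.
apply: card_superset_family => [|A]; first by rewrite subUset !sub1set uS.
rewrite !inE => /andP[/andP[/sG]]; rewrite inE => /andP[sAS /eqP cA] vA uA.
by rewrite subUset !sub1set uA vA c2.
Qed.

(** Both sides count pairs (A, u) with A in G and u in A :&: U, and each A that
    meets U contributes at least one. *)
Lemma card_meeting_le G U : #|meeting G U| <= \sum_(u in U) #|star G u|.
Proof.
apply: (@leq_trans (\sum_(A in G) #|A :&: U|)).
  rewrite -sum1_card (eq_bigl (fun A => (A \in G) && ~~ [disjoint A & U]));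
    last by move=> A; rewrite inE.
  rewrite big_mkcondr; apply: leq_sum => A _; case: ifP => //.
  by rewrite -setI_eq0 -cards_eq0 lt0n.
rewrite (eq_bigr (fun A => \sum_(u in U) (u \in A : nat))); last first.
  move=> A _; rewrite -sum1_card (eq_bigl (fun u => (u \in U) && (u \in A)));
    last by move=> u; rewrite inE andbC.
  by rewrite big_mkcondr; apply: eq_bigr => u _; case: (u \in A).
rewrite exchange_big; apply/eq_leq/eq_bigr => u _.
rewrite -sum1_card [RHS](eq_bigl (fun A => (A \in G) && (u \in A)));
  last by move=> A; rewrite inE.
by rewrite big_mkcondr; apply: eq_bigr => A _; case: (u \in A).
Qed.

Lemma avoiding_member G U : #|meeting G U| < #|G| ->
  exists2 A, A \in G & [disjoint A & U].
Proof.
move=> lt; case: (boolP [exists A in G, [disjoint A & U]]) => [/exists_inP//|].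
rewrite negb_exists_in => /forall_inP h; move: lt.
suff -> : meeting G U = G by rewrite ltnn.
by apply/setP=> A; rewrite inE; case: (boolP (A \in G)) => //= /h ->.
Qed.

(** * Systems of representatives *)

(** Each set has at least as many elements as there are indices, so a greedy
    choice never gets stuck. *)
Lemma distinct_representatives (x0 : T) P (H : I -> {set T}) :
  {in P, forall i, #|P| <= #|H i|} ->
  exists v : I -> T,
    {in P, forall i, v i \in H i} /\ {in P &, injective v}.
Proof.
have [m] := ubnP #|P|; elim: m P => // m IHm P ltPm hH.
have [->|[i0 Pi0]] := set_0Vmem P.
  by exists (fun=> x0); split=> i; rewrite inE.
have cP := cardsD1 i0 P; rewrite Pi0 in cP.
have [|i /setD1P[_ Pi]|v [vH v_inj]] := IHm (P :\ i0).
- by lia.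
- by have := hH i Pi; lia.
have : 0 < #|H i0 :\: v @: (P :\ i0)|.
  rewrite cardsD; have := hH i0 Pi0.
  have := leq_imset_card v (P :\ i0).
  have := subset_leq_card (subsetIr (H i0) (v @: (P :\ i0))); lia.
case/card_gt0P=> x /setDP[xH xv].
exists (fun i => if i == i0 then x else v i); split=> [i Pi|i j Pi Pj].
  by case: eqVneq => [->//|ne]; apply: vH; rewrite !inE ne.
have notx j' : j' \in P -> j' != i0 -> x = v j' -> False.
  by move=> Pj' ne eqx; case/imsetP: xv; exists j' => //; rewrite !inE ne.
case: eqVneq => [->|nei]; case: eqVneq => [->|nej] //.
- by move/(notx j Pj nej).
- by move/esym/(notx i Pi nei).
by apply: v_inj; rewrite !inE ?nei ?nej.
Qed.

Definition rainbow (F : I -> {set {set T}}) P :=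
  exists f : I -> {set T}, {in P, forall i, f i \in F i} /\
    {in P &, forall i j, i != j -> [disjoint f i & f j]}.

(** The form of both inductions on the number of families: solve the problem for
    all indices but i, possibly inside subfamilies F' on a smaller ground set S,
    then find a member of F i that avoids the union U of the sets chosen. *)
Lemma rainbow_extend (F F' : I -> {set {set T}}) S P i k : i \in P ->
  {in P :\ i, forall j, F' j \subset F j} ->
  {in P :\ i, forall j, F' j \subset ksubsets S k} ->
  rainbow F' (P :\ i) ->
  (forall U, U \subset S -> #|U| <= #|P :\ i| * k ->
     exists2 A, A \in F i & [disjoint A & U]) ->
  rainbow F P.
Proof.
move=> Pi sF'F sF'S [f [fF' f_disj]] hU.
pose U := \bigcup_(j in P :\ i) f j.
have fS j : j \in P :\ i -> f j \subset S /\ #|f j| = k.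
  move=> Pj; have /(subsetP (sF'S j Pj)) := fF' j Pj.
  by rewrite inE => /andP[-> /eqP].
have [||A AF dA] := hU U.
- by apply/bigcupsP=> j /fS[].
- rewrite -sum_nat_const; apply: (@leq_trans (\sum_(j in P :\ i) #|f j|)).
    apply: (big_ind2 (fun (B : {set T}) c => #|B| <= c)); rewrite ?cards0 //.
    move=> B1 c1 B2 c2 le1 le2.
    exact: leq_trans (leq_card_setU B1 B2) (leq_add le1 le2).
  by apply: leq_sum => j /fS[_ ->].
have dAf j : j \in P :\ i -> [disjoint A & f j].
  by move=> Pj; apply: disjointWr dA; apply: bigcup_sup.
exists (fun j => if j == i then A else f j); split=> [j Pj|j l Pj Pl neq].
  case: eqVneq => [->//|ne]; have Pj' : j \in P :\ i by rewrite !inE ne.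
  exact: (subsetP (sF'F j Pj')) (fF' j Pj').
case: eqVneq => [ej|nej]; case: eqVneq => [el|nel].
- by rewrite ej el eqxx in neq.
- by apply: dAf; rewrite !inE nel.
- by rewrite disjoint_sym; apply: dAf; rewrite !inE nej.
by apply: f_disj; rewrite // !inE ?nej ?nel.
Qed.

(** * Links *)

(** The link of v in G, restricted to the sets that avoid V; the vertex v is
    itself expected in V. *)
Definition link G v V := [set A :\ v | A in star G v :\: meeting G (V :\ v)].

Lemma linkP G v V B : B \in link G v V ->
  [/\ v |: B \in G, v \notin B & [disjoint B & V]].
Proof.
case/imsetP=> A /setDP[]; rewrite !inE => /andP[AG vA].
rewrite AG /= negbK => dA ->; rewrite setD1K // setD11; split=> //.
apply/pred0P=> x /=; rewrite !inE; case: eqVneq => //= nxv.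
by have /pred0P/(_ x) := dA; rewrite /= !inE nxv.
Qed.

Lemma link_ksubsets G S v V k : G \subset ksubsets S k.+1 ->
  link G v V \subset ksubsets (S :\: V) k.
Proof.
move=> /subsetP sG; apply/subsetP=> B /linkP[/sG vBG vB dB].
move: vBG; rewrite !inE cardsU1 vB add1n eqSS => /andP[sBS ->].
rewrite andbT subsetD dB andbT.
exact: subset_trans (subsetUr _ _) sBS.
Qed.

(** A member through v that is lost contains v and another point of V, and
    'C(#|S| - 2, k) bounds the number of those for each such point. *)
Lemma card_link_ge G S v V k : G \subset ksubsets S k.+2 ->
  v \in V -> V \subset S ->
  #|star G v| <= #|link G v V| + #|V|.-1 * 'C(#|S| - 2, k).
Proof.
move=> sG vV sVS; rewrite card_in_imset; last first.
  move=> A B /setDP[+ _] /setDP[+ _]; rewrite !inE => /andP[_ vA] /andP[_ vB] eqAB.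
  by rewrite -(setD1K vA) -(setD1K vB) eqAB.
rewrite -(cardsID (meeting G (V :\ v)) (star G v)) addnC leq_add2l.
apply: (@leq_trans #|meeting (star G v) (V :\ v)|).
  apply/subset_leq_card/subsetP=> A; rewrite !inE.
  by case/and3P=> /andP[-> ->] _ ->.
apply: leq_trans (card_meeting_le _ _) _.
have <- : #|V :\ v| = #|V|.-1 by rewrite (cardsD1 v V) vV.
rewrite -sum_nat_const; apply: leq_sum => u /setD1P[nuv uV].
by apply: (card_star2_le sG) => //; apply: (subsetP sVS).
Qed.

(** Putting v i back preserves disjointness because the v i are distinct and the
    sets of the links avoid all of them. *)
Lemma rainbow_links (F : I -> {set {set T}}) P (v : I -> T) :
  {in P &, injective v} ->
  rainbow (fun i => link (F i) (v i) (v @: P)) P -> rainbow F P.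
Proof.
move=> v_inj [f [fF f_disj]].
exists (fun i => v i |: f i); split=> [i /fF/linkP[]//|i j Pi Pj nij].
have [_ _ di] := linkP (fF i Pi); have [_ _ dj] := linkP (fF j Pj).
have nv : v i != v j by apply: contraNneq nij => /v_inj ->.
apply/pred0P=> x; apply/negbTE; rewrite /= !inE; apply/negP=> /andP[].
case/predU1P=> [->|xi].
  rewrite (negbTE nv) /= => xj.
  by have := disjointFr dj xj; rewrite imset_f.
case/predU1P=> [exj|xj].
  by have := disjointFr di xi; rewrite exj imset_f.
by have := disjointFr (f_disj i j Pi Pj nij) xi; rewrite xj.
Qed.

(** * The double induction *)

(** The size hypothesis of the theorem for s + 1 families, with the subtraction
    of binomial coefficients moved to the other side. *)
Definition large (F : I -> {set {set T}}) S P k s :=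
  {in P, forall i, F i \subset ksubsets S k /\
                   'C(#|S|, k) < #|F i| + 'C(#|S| - s, k)}.

(** Base of the induction on k: disjoint singletons are distinct points. *)
Lemma rainbow_singletons F S P s : #|P| = s.+1 -> s.+1 <= #|S| ->
  large F S P 1 s -> rainbow F P.
Proof.
move=> cP le_sS hF.
have [x0 _] : exists x, x \in S by apply/card_gt0P; lia.
pose H i := [set x | [set x] \in F i].
have cH : {in P, forall i, #|P| <= #|H i|}.
  move=> i /hF[/subsetP sF]; rewrite !bin1 cP => cF.
  suff eF : F i = set1 @: H i.
    by move: cF; rewrite [in #|F i|]eF card_imset; [lia|exact: set1_inj].
  apply/setP=> A; apply/idP/imsetP=> [AF|[x]]; last by rewrite inE => xF ->.
  have := sF A AF; rewrite inE => /andP[_ /cards1P[x eA]].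
  by exists x => //; rewrite inE -eA.
have [v [vH v_inj]] := distinct_representatives x0 cH.
exists (fun i => [set v i]); split=> [i /vH|i j Pi Pj nij]; first by rewrite inE.
by rewrite disjoints1 inE; apply: contraNneq nij => /v_inj ->.
Qed.

(** Deleting v costs each family at most 'C(#|S| - 1, k) sets, exactly the drop
    from 'C(#|S|, k + 1) to 'C(#|S| - 1, k + 1); meanwhile #|S| - s.+1 stays the
    same when #|S| and s.+1 both decrease by one. *)
Lemma large_delete F S P v k s : v \in S -> s < #|S| ->
  large F S P k.+1 s.+1 ->
  large (fun i => F i :\: star (F i) v) (S :\ v) P k.+1 s.
Proof.
move=> vS lt_s hF i /hF[sF cF]; have cS := cardsD1 v S; rewrite vS add1n in cS.
split.
  apply/subsetP=> A /setDP[AF]; rewrite inE AF /= => vA.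
  have := subsetP sF A AF; rewrite !inE subsetD1 vA andbT.
  by [].
have := card_star_le sF vS; have := cardsID (star (F i) v) (F i).
have := subset_leq_card (subsetIr (F i) (star (F i) v)).
move: cF; rewrite cS subSS binS /=; lia.
Qed.

Lemma large_weaken F S P k s : large F S P k s.+1 -> large F S P k s.
Proof.
move=> hF i /hF[sF cF]; split=> //; apply: leq_trans cF _.
by rewrite leq_add2l leq_bin2l //; lia.
Qed.

Lemma rainbow_matching k s S F P : #|P| = s.+1 -> 3 * k.+1 ^ 2 * s.+1 < #|S| ->
  large F S P k.+1 s -> rainbow F P.
Proof.
elim: k s S F P => [|k IHk] s S F P cP lt_n hF.
  by apply: rainbow_singletons hF; lia.
elim: s S F P cP lt_n hF => [|s IHs] S F P cP lt_n hF.
  have [i eP] : exists i, P = [set i] by apply/cards1P/eqP.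
  have Pi : i \in P by rewrite eP set11.
  have [A AF] : exists A, A \in F i.
    by apply/card_gt0P; have [_] := hF i Pi;
      rewrite subn0 -[X in X < _]add0n ltn_add2r.
  exists (fun=> A); split=> [j|j l]; rewrite eP !inE => /eqP-> // /eqP->.
  by rewrite eqxx.
have cP' i : i \in P -> #|P :\ i| = s.+1.
  by move=> Pi; have := cardsD1 i P; rewrite Pi cP; lia.
have lt_S : 12 * s.+2 < #|S|.
  by apply: leq_ltn_trans lt_n; rewrite leq_mul2r; nia.
have lt_s : s.+1 < #|S| by lia.
pose D := 'C(#|S| - 2, k).
have hF' i : large F S (P :\ i) k.+2 s.+1 by move=> j /setD1P[_ /hF].
(* A vertex of high degree in F i can be covered last, so it is deleted from the
   other families. *)
case: (boolP [exists i in P, exists v in S,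
                k.+2 * s.+1 * D < #|star (F i) v|]).
  case/exists_inP=> i Pi /exists_inP[v vS hv].
  have cS := cardsD1 v S; rewrite vS add1n in cS.
  apply: (@rainbow_extend _ (fun i => F i :\: star (F i) v) (S :\ v) P i k.+2) => //.
  - by move=> j _; apply: subsetDl.
  - by move=> j Pj; have [] := large_delete vS (ltnW lt_s) (@hF' i) Pj.
  - apply: (IHs (S :\ v) _ _ (cP' i Pi)).
      by move: lt_n; rewrite cS; nia.
    exact: large_delete vS (ltnW lt_s) (@hF' i).
  (* As v is not in U, each u in U lies in at most D members through v. *)
  move=> U sU cU; rewrite cP' // in cU.
  have [|A] := @avoiding_member (star (F i) v) U.
    apply: leq_ltn_trans (card_meeting_le _ _) _.
    apply: (@leq_ltn_trans (\sum_(u in U) D)).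
      apply: leq_sum => u /(subsetP sU)/setD1P[nuv uS].
      by apply: card_star2_le => //; case: (hF i Pi).
    rewrite sum_nat_const; apply: leq_ltn_trans hv.
    by rewrite leq_mul2r (leq_trans cU) ?orbT // mulnC.
  by rewrite inE => /andP[AF _] dA; exists A.
rewrite negb_exists_in => /forall_inP low.
have {}low i v : i \in P -> v \in S -> #|star (F i) v| <= k.+2 * s.+1 * D.
  by move=> /low; rewrite negb_exists_in => /forall_inP h /h; rewrite -leqNgt.
pose heavy i := [set v in S | 2 * s.+1 * D < #|star (F i) v|].
case: (boolP [forall i in P, #|P| <= #|heavy i|]) => [/forall_inP cH|].
  (* Distinct heavy vertices for all families: pass to their links. *)
  have [x0 _] : exists x, x \in S by apply/card_gt0P; lia.
  have [v [vH v_inj]] := distinct_representatives x0 cH.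
  have sV : v @: P \subset S.
    by apply/subsetP=> _ /imsetP[i /vH + ->]; rewrite inE => /andP[].
  have cV : #|v @: P| = s.+2 by rewrite card_in_imset.
  have cSV : #|S :\: v @: P| = #|S| - s.+2 by rewrite cardsD (setIidPr sV) cV.
  apply: (rainbow_links v_inj); apply: (IHk s.+1 (S :\: v @: P)) => //.
    by rewrite cSV; nia.
  move=> i Pi; have [sF _] := hF i Pi; split; first exact: link_ksubsets.
  have := card_link_ge sF (imset_f v Pi) sV; rewrite cV cSV /=.
  have := vH i Pi; rewrite inE => /andP[_]; rewrite -/D.
  have le_s : s.+1 <= #|S| - s.+2 by lia.
  have := @bin_sub_upper _ s.+1 k le_s.
  have : s.+1 * 'C((#|S| - s.+2).-1, k) <= s.+1 * D.
    by rewrite leq_mul2l leq_bin2l //; lia.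
  rewrite -mulnA.
  have key x y e d g l :
    e <= d -> x <= y + e -> 2 * d < g -> g <= l + d -> x < l + y by lia.
  exact: key.
(* Now F i has at most s.+1 heavy vertices, so U contains few of them. *)
rewrite negb_forall_in => /exists_inP[i Pi]; rewrite -ltnNge cP ltnS => cH.
apply: (@rainbow_extend _ F S P i k.+2) => //.
- by move=> j /setD1P[_ /hF[]].
- by apply: (IHs S _ _ (cP' i Pi)); [nia|apply: large_weaken].
move=> U sU; rewrite cP' // => cU.
apply: avoiding_member; apply: leq_ltn_trans (card_meeting_le _ _) _.
have [sF cF] := hF i Pi.
have := @bin_gap #|S| s.+1 k isT lt_n; rewrite -/D => gap.
apply: (@leq_ltn_trans (s.+1 ^ 2 * (3 * k + 4) * D)); last by lia.
rewrite (big_setID (heavy i)) /=.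
apply: (@leq_trans (\sum_(u in U :&: heavy i) k.+2 * s.+1 * D
                   + \sum_(u in U :\: heavy i) 2 * s.+1 * D)).
  apply: leq_add; apply: leq_sum => u.
    by case/setIP=> /(subsetP sU) uS _; apply: low.
  by case/setDP=> /(subsetP sU) uS; rewrite inE uS /= -leqNgt.
rewrite !sum_nat_const.
have := cardsID (heavy i) U.
have := subset_leq_card (subsetIr U (heavy i)).
move: #|U :&: heavy i| #|U :\: heavy i| => a b le_a eq_ab.
(* Each point of U counts 2 s D members (with s.+1 here for s), and each of the
   heavy ones at most (k.+2 - 2) s D more. *)
have -> : a * (k.+2 * s.+1 * D) + b * (2 * s.+1 * D)
  = (a * k + #|U| * 2) * (s.+1 * D) by rewrite -eq_ab; ring.
have -> : s.+1 ^ 2 * (3 * k + 4) * D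
  = (s.+1 * k + (s.+1 * k.+2) * 2) * (s.+1 * D) by ring.
by rewrite leq_mul2r leq_add ?orbT // leq_mul2r ?cU ?(leq_trans le_a cH) ?orbT.
Qed.
End Families.

Theorem theorem3p3 (n k t : nat) (hn : 0 < n) (hk : 0 < k) (ht : 0 < t)
    (htn : (t%:R < n%:R / (3%:R * k%:R ^+ 2) :> rat)%R)
    (F : 'I_t -> {set {set 'I_n}})
    (hFk : forall (i : 'I_t) (A : {set 'I_n}), A \in F i -> #|A| = k)
    (hF : forall i : 'I_t, 'C(n, k) - 'C(n - t + 1, k) < #|F i|) :
  exists f : 'I_t -> {set 'I_n},
    (forall i : 'I_t, f i \in F i) /\
    (forall i j : 'I_t, i != j -> [disjoint f i & f j]).
Proof.
case: k hk htn hFk hF => // k _ htn hFk hF.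
case: t ht htn F hFk hF => // s _ htn F hFk hF.
have lt_n : 3 * k.+1 ^ 2 * s.+1 < n.
  move: htn; rewrite ltr_pdivlMr; last by rewrite mulr_gt0 ?exprn_gt0 ?ltr0n.
  by rewrite -natrX -!natrM ltr_nat mulnC.
have [|||f [fF f_disj]] := @rainbow_matching _ _ k s [set: 'I_n] F [set: 'I_s.+1].
- by rewrite cardsT card_ord.
- by rewrite cardsT card_ord.
- move=> i _; rewrite cardsT card_ord; split.
    by apply/subsetP=> A AF; rewrite inE subsetT (hFk i) /=.
  have := hF i; have -> : n - s.+1 + 1 = n - s by nia.
  lia.
by exists f; split=> [i|i j]; [apply: fF|apply: f_disj]; rewrite inE.
Qed.
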